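(* Every weakly nil clean PI-ring is strongly $\pi$-regular.
   Context: Rings are associative with unity, not necessarily commutative. A ring $R$ is weakly nil clean if for every $a\in R$ there exist an idempotent $e\in R$ and a nilpotent $q\in R$ such that $a-e-q\in eRa$. A ring $R$ is a PI-ring if $R$ satisfies a polynomial identity (in non-commuting indeterminates) with coefficients in $\mathbb{Z}$, at least one of whose coefficients is invertible. A ring $R$ is strongly $\pi$-regular if for every $a\in R$ there exists a positive integer $n$ such that $a^n\in a^{n+1}R$. *)

(* Defs.v *)
From mathcomp Require Import all_boot all_order all_algebra.
From mathcomp Require Import finmap.
From mathcomp Require Import monalg.

Set Implicit Arguments.
Unset Strict Implicit.
Unset Printing Implicit Defensive.

Import GRing.Theory.
Local Open Scope ring_scope.

(* Rings are [pzRingType]s: associative, unital, not necessarily commutative,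
   the zero ring being allowed. *)

Definition is_idempotent (R : pzRingType) (e : R) : Prop := e * e = e.

Definition is_nilpotent (R : pzRingType) (q : R) : Prop :=
  exists n : nat, q ^+ n = 0.

Definition weakly_nil_clean (R : pzRingType) : Prop :=
  forall a : R, exists e q : R,
    [/\ is_idempotent e, is_nilpotent q & exists r : R, a - e - q = e * r * a].

(* The free ring Z<x_0, x_1, ...>: the monoid ring over [int] of the free
   monoid on [nat]. *)
Definition ncpoly := {malg int[{fmonom nat}]}.

(* [mmap] from monalg only evaluates into nontrivial rings. The product over a
   word is taken in order. *)
Definition nceval (R : pzRingType) (v : nat -> R) (f : ncpoly) : R :=
  \sum_(m <- msupp f) (\prod_(i <- (m : seq nat)) v i) *~ f@_m.

Definition polynomial_identity (R : pzRingType) (f : ncpoly) : Prop :=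
  forall v : nat -> R, nceval v f = 0.

Definition PI_ring (R : pzRingType) : Prop :=
  exists f : ncpoly,
    (exists m : {fmonom nat}, f@_m \is a GRing.unit) /\
    polynomial_identity R f.

Definition strongly_pi_regular (R : pzRingType) : Prop :=
  forall a : R, exists n : nat,
    (0 < n)%N /\ exists r : R, a ^+ n = a ^+ n.+1 * r.

(* Main.v *)
(* Zorn's lemma gives an ideal P maximal among those modulo which the chain
   a^n R never stabilises; the maximality of P forces P to be prime, so one may
   assume R prime.  In a prime PI-ring nil left ideals vanish and every
   nonempty set of idempotents has a maximal element.  Weak nil cleanness puts
   a nonzero idempotent in every non-nil left ideal; hence, for f a maximal
   idempotent of Ra, the left ideal Ra(1 - f) is nil, so zero, and R is von
   Neumann regular.  The right ideals a^n R are then generated by idempotents,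
   and the chain they form stabilises. *)

Require Import Defs.
From HB Require Import structures.
From mathcomp Require Import all_boot all_order all_algebra.
From mathcomp Require Import boolp classical_sets.
From mathcomp Require Import generic_quotient ring_quotient.
From mathcomp Require Import finmap monalg.

Set Implicit Arguments.
Unset Strict Implicit.
Unset Printing Implicit Defensive.

Import GRing.Theory.
Local Open Scope ring_scope.

(** * Noncommutative polynomials as lists of terms *)

(* A pair of a word and an integer stands for a monomial with its coefficient;
   a word may be repeated, its coefficients then add up. *)
Definition terms_eval (R : pzRingType) (v : nat -> R)
    (s : seq (seq nat * int)) : R :=
  \sum_(p <- s) (\prod_(i <- p.1) v i) *~ p.2.

Definition terms_coef (s : seq (seq nat * int)) (w : seq nat) : int :=
  \sum_(p <- s | p.1 == w) p.2.

(* [j * lquot j s] collects the terms of [s] whose word starts with [j]. *)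
Definition lquot (j : nat) (s : seq (seq nat * int)) : seq (seq nat * int) :=
  [seq (behead p.1, p.2) | p <- s & ohead p.1 == Some j].

Lemma terms_coef_lquot j s w : terms_coef (lquot j s) w = terms_coef s (j :: w).
Proof.
rewrite /terms_coef /lquot big_map big_filter_cond.
by apply: eq_bigl => -[[|i u] k] //=; rewrite eqseq_cons.
Qed.

Lemma terms_eval0 (R : pzRingType) s :
  terms_eval (fun=> 0 : R) s = (terms_coef s [::])%:~R.
Proof.
rewrite /terms_eval /terms_coef rmorph_sum /= [RHS]big_mkcond /=.
apply: eq_bigr => -[[|i u] k] _ /=; first by rewrite big_nil.
by rewrite big_cons mul0r mul0rz.
Qed.

(** When a word is expanded, an [x] that is not the first letter has some [v i] or another [x] just
    before it, so the product vanishes. *)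
Lemma terms_eval_lquot (R : pzRingType) (v : nat -> R) (x : R) (j : nat) s :
  (forall i, v i * x = 0) -> x * x = 0 ->
  terms_eval (fun i => v i + (if i == j then x else 0)) s
    = terms_eval v s + x * terms_eval v (lquot j s).
Proof.
move=> vx0 xx0.
pose tl w := if ohead w == Some j then x * \prod_(i <- behead w) v i else 0.
have vtl i w : v i * tl w = 0.
  by rewrite /tl; case: ifP; rewrite ?mulr0 // mulrA vx0 mul0r.
have xtl w : x * tl w = 0.
  by rewrite /tl; case: ifP; rewrite ?mulr0 // mulrA xx0 mul0r.
have word w : \prod_(i <- w) (v i + (if i == j then x else 0))
    = \prod_(i <- w) v i + tl w.
  elim: w => [|i w IHw]; first by rewrite !big_nil addr0.
  rewrite !big_cons IHw mulrDl !mulrDr vtl addr0 /tl /=; congr (_ + _).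
  rewrite (inj_eq (@Some_inj _)).
  by case: eqP => _; rewrite ?mul0r ?addr0 // xtl addr0.
rewrite /terms_eval /lquot big_map big_filter mulr_sumr [X in _ + X]big_mkcond.
rewrite -big_split; apply: eq_bigr => -[w k] _ /=.
by rewrite word mulrzDl /tl; case: ifP => _; rewrite ?mul0rz ?mulrzAr.
Qed.

(** * Descent along an identity in a prime ring *)

Definition prime_ring (R : pzRingType) : Prop :=
  forall x y : R, (forall r, x * r * y = 0) -> x = 0 \/ y = 0.

Definition has_PI_terms (R : pzRingType) : Prop :=
  exists s w, terms_coef s w \is a GRing.unit /\
    forall v : nat -> R, terms_eval v s = 0.

(* Perturbing the value of the variable [j] by [t * y * c'] turns the identity
   [c * s = 0] on [A] into [c * t * y * c' * lquot j s = 0] on [A'], so that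
   primeness yields [c' * lquot j s = 0] on [A'].  Peeling off in this way all
   the letters of a word with invertible coefficient gives a contradiction. *)
Lemma no_infinite_descent (R : pzRingType) (Q : R -> (R -> Prop) -> Prop) :
    prime_ring R -> has_PI_terms R ->
    (forall c A, Q c A -> A 0) ->
    (forall c A, Q c A -> exists t c' A', [/\ Q c' A', c * t != 0, c' * t = 0
       & forall v, A' v -> [/\ A v, v * t = 0
         & forall y, A (v + t * y * c')]]) ->
  forall c A, ~ Q c A.
Proof.
move=> primeR [s [w [uw sv0]]] QA0 Qstep c A QcA.
(* The induction keeps only the vanishing of [c * s] on [A], the form that [lquot] inherits. *)
have {sv0} : forall v, (forall i, A (v i)) -> c * terms_eval v s = 0.
  by move=> v _; rewrite sv0 mulr0.
elim: w s uw c A QcA => [|j w IHw] s uw c A QcA sc0;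
  have [t [c' [A' [QcA' ct0 c't0 A'P]]]] := Qstep _ _ QcA.
  (* At the zero assignment only the constant coefficient survives; here it is invertible, so
     [c = 0], against [c * t != 0]. *)
  have := sc0 (fun=> 0) (fun=> QA0 _ _ QcA).
  rewrite terms_eval0 mulrzAr mulr1.
  move/(congr1 (fun z => z *~ (terms_coef s [::])^-1)).
  rewrite -mulrzA divrr // mul0rz mulr1z => c0.
  by rewrite c0 mul0r eqxx in ct0.
apply: (IHw (lquot j s) _ c' A' QcA'); first by rewrite terms_coef_lquot.
move=> v Av.
suff: forall y, c * t * y * (c' * terms_eval v (lquot j s)) = 0.
  by move/primeR => [/eqP|//]; rewrite (negPf ct0).
move=> y; have Av' i := A'P _ (Av i).
have := sc0 (fun i => v i + (if i == j then t * y * c' else 0)) _.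
rewrite terms_eval_lquot => [|i|]; first last.
- by rewrite !mulrA -[_ * c' * t]mulrA c't0 mulr0 !mul0r.
- by have [_ vt0 _] := Av' i; rewrite !mulrA vt0 !mul0r.
rewrite mulrDr sc0 => [|i]; last by have [] := Av' i.
rewrite add0r !mulrA; apply=> i.
by have [Ai _ Aix] := Av' i; case: ifP => _; rewrite ?addr0.
Qed.

(** Otherwise each [e] in [S] lies strictly below some [e'] in [S], and the descent runs with
    [c = t = e' - e] on the left annihilator of [e]. *)
Lemma exists_maximal_idempotent (R : pzRingType) (S : R -> Prop) (e0 : R) :
    prime_ring R -> has_PI_terms R ->
    S e0 -> (forall e, S e -> is_idempotent e) ->
  exists e, S e /\ forall e', S e' -> e * e' = e -> e' * e = e -> e' = e.
Proof.
move=> primeR PIR Se0 idS; apply: contrapT => noMax.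
have larger e : S e -> exists e', [/\ S e', e * e' = e, e' * e = e & e' <> e].
  move=> Se; apply: contrapT => noLarger; apply: noMax; exists e; split=> // e'.
  by move=> Se' ee' e'e; apply: contrapT => ne; apply: noLarger; exists e'.
pose Q c A := exists e e', 
  [/\ S e, S e', e * e' = e, e' * e = e & e' <> e] /\
  c = e' - e /\ A = (fun v => v * e = 0).
have [e1 [Se1 e01 e10 ne01]] := larger _ Se0.
apply: (no_infinite_descent primeR PIR (Q := Q) _ _
          (c := e1 - e0) (A := fun v => v * e0 = 0)).
- by move=> c A [e [e' [_ [_ ->]]]]; rewrite mul0r.
- move=> c A [e [e' [[Se Se' ee' e'e nee'] [-> ->]]]].
  have [e'' [Se'' e'e'' e''e' ne'e'']] := larger _ Se'.
  have e''e : e'' * e = e by rewrite -e'e mulrA e''e'.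
  exists (e' - e), (e'' - e'), (fun v => v * e' = 0); split.
  + by exists e', e''.
  + rewrite mulrBl !mulrBr ee' e'e (idS _ Se) (idS _ Se') subrr subr0 subr_eq0.
    by apply/eqP.
  + by rewrite mulrBl !mulrBr e''e e''e' e'e (idS _ Se') subrr.
  + move=> v ve'; have ve : v * e = 0 by rewrite -e'e mulrA ve' mul0r.
    split=> [//||y]; first by rewrite mulrBr ve ve' subrr.
    rewrite mulrDl ve add0r -mulrA [(e'' - e') * e]mulrBl.
    by rewrite e''e e'e subrr mulr0.
- by exists e0, e1.
Qed.

(** * Nil left ideals in prime PI-rings *)

Lemma last_nonzero_power (R : pzRingType) (c x : R) (k : nat) :
    is_nilpotent x -> c * x ^+ k != 0 ->
  exists m, [/\ (k <= m)%N, c * x ^+ m != 0 & c * x ^+ m.+1 = 0].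
Proof.
move=> [n xn0] cxk.
have ex : exists n, c * x ^+ n == 0 by exists n; rewrite xn0 mulr0.
case: (ex_minnP ex) => -[|m] /eqP cxm min_m.
  by move: cxk; rewrite (_ : c = 0) ?mul0r ?eqxx // -(mulr1 c).
have ltkm : (k < m.+1)%N.
  rewrite ltnNge; apply: contra cxk => lemk.
  by rewrite -(subnKC lemk) exprD mulrA cxm mul0r.
exists m; split=> //.
by apply/negP => /min_m; rewrite ltnn.
Qed.

(** Linearising in [r] gives [c r c s c = - c s c r c]. Hence [c r c y c r c = - c y c r c r c = 0],
    and primeness applies twice. *)
Lemma prime_sandwich_eq0 (R : pzRingType) (c : R) :
  prime_ring R -> (forall r, c * r * c * r * c = 0) -> c = 0.
Proof.
move=> primeR c0.
have anti r s : c * r * c * s * c = - (c * s * c * r * c).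
  have := c0 (r + s).
  rewrite !(mulrDr, mulrDl) !c0 add0r addr0 => /eqP.
  by rewrite addrC addr_eq0 => /eqP.
have crc r : c * r * c = 0.
  suff: forall y, c * r * c * y * (c * r * c) = 0 by case/primeR.
  move=> y; rewrite !mulrA anti !mulNr; have := c0 r; rewrite -!mulrA => ->.
  by rewrite !mulr0 oppr0.
by case: (primeR _ _ crc).
Qed.

Lemma expr_double_eq0 (R : pzRingType) (x : R) (m : nat) :
  (0 < m)%N -> x ^+ m.+1 = 0 -> x ^+ m * x ^+ m = 0.
Proof.
by case: m => // m _ x0; rewrite -exprD addSnnS addnC exprD x0 mul0r.
Qed.

(** The descent runs through nonzero square-zero [c] with [R c] nil, taking [A = R c]. It starts at
    a power of [b] and passes from [c] to a power of some [r c], which serves as both [t] and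
    [c']. *)
Lemma nil_left_ideal_eq0 (R : pzRingType) (b : R) :
    prime_ring R -> has_PI_terms R -> (forall r, is_nilpotent (r * b)) -> b = 0.
Proof.
move=> primeR PIR nilb; apply/eqP; apply/negP => /negP b0.
pose Q (c : R) A := [/\ c != 0, c * c = 0, forall r, is_nilpotent (r * c)
  & A = (fun v => exists r, v = r * c)].
have [m [m0 bm bm1]] : exists m,
    [/\ (1 <= m)%N, 1 * b ^+ m != 0 & 1 * b ^+ m.+1 = 0].
  by apply: last_nonzero_power; rewrite ?mul1r //; rewrite -(mul1r b).
rewrite !mul1r in bm bm1.
apply: (no_infinite_descent primeR PIR (Q := Q) _ _
          (c := b ^+ m) (A := fun v => exists r, v = r * b ^+ m)).
- by move=> c A [_ _ _ ->]; exists 0; rewrite mul0r.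
- move=> c A [c0 cc nilc ->].
  have [r cr0] : exists r, c * r * c * r * c <> 0.
    apply: contrapT => all0; move/eqP: c0; apply.
    apply: prime_sandwich_eq0 => // r.
    by apply: contrapT => ?; apply: all0; exists r.
  (* The bound [2 <= k] gives [k + 2 <= 2 k], so that [d * d] has the factor
     [r c (r c)^(k+1) = 0]. *)
  have [k [k2 ck ck1]] : exists k,
      [/\ (2 <= k)%N, c * (r * c) ^+ k != 0 & c * (r * c) ^+ k.+1 = 0].
    by apply: last_nonzero_power => //; apply/eqP; rewrite expr2 !mulrA.
  have k1 : (0 < k)%N by apply: ltnW.
  set d := (r * c) ^+ k in ck *.
  have dE : d = (r * c) ^+ k.-1 * r * c by rewrite -mulrA -exprSr prednK.
  have dd : d * d = 0.
    rewrite /d -exprD (_ : k + k = k.+2 + (k - 2))%N.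
      by rewrite exprD exprS -(mulrA r) ck1 mulr0 mul0r.
    by rewrite -addn2 -addnA subnKC.
  exists d, d, (fun v => exists r, v = r * d); split=> //.
  + split=> //; first by apply: contraNneq ck => ->; rewrite mulr0.
    by move=> s; rewrite dE !mulrA; apply: nilc.
  + move=> _ [s ->]; split=> [||y].
    * by exists (s * (r * c) ^+ k.-1 * r); rewrite dE !mulrA.
    * by rewrite -mulrA dd mulr0.
    * exists ((s + d * y) * (r * c) ^+ k.-1 * r).
      by rewrite -mulrDl {2}dE !mulrA.
- split=> //; first by apply: expr_double_eq0.
  by move=> r; rewrite -(prednK m0) exprSr mulrA.
Qed.

(** * Idempotents and regularity in the prime case *)

Lemma unipotent_invertible (R : pzRingType) (q : R) :
  is_nilpotent q -> exists w, w * (1 + q) = 1 /\ (1 + q) * w = 1.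
Proof.
move=> [n qn0]; pose w := \sum_(i < n) (- q) ^+ i; exists w.
have uw : (1 + q) * w = 1.
  have := subrX1 (- q) n; rewrite exprNn qn0 mulr0 sub0r -opprD mulNr.
  by move/oppr_inj; rewrite addrC.
split=> //; rewrite -{}[RHS]uw.
apply/esym; apply: commr_sum => i _; apply: commrX; apply: commrN.
by apply/commr_sym; apply: commrD; [apply: commr1 | ].
Qed.

(** Multiplying [x - e - q = e r x] by [e] on the left gives [e (1 + q) = e (1 - r) x], so the
    conjugate of [e] by the unit [1 + q] lies in [R x]. It is nonzero, since [e = 0] would make
    [x = q] nilpotent. *)
Lemma weakly_nil_clean_idempotent (R : pzRingType) (x : R) :
    weakly_nil_clean R -> ~ is_nilpotent x ->
  exists g, [/\ is_idempotent g, g != 0 & exists s, g = s * x].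
Proof.
move=> wnc nilx; have [e [q [ee nilq [r exq]]]] := wnc x.
have [w [wu uw]] := unipotent_invertible nilq.
have eu : e * (1 + q) = e * (1 - r) * x.
  have := congr1 (fun z => e * z) exq; rewrite !mulrA !mulrBr !(ee : e * e = e).
  by rewrite mulrDr !mulrBl mulr1 => <-; rewrite -addrA -opprD subKr.
exists (w * e * (1 + q)); split.
- rewrite /is_idempotent !mulrA -[_ * (1 + q) * w]mulrA uw mulr1.
  by rewrite -[w * e * e]mulrA (ee : e * e = e).
- apply/eqP => g0; apply: nilx.
  have e0 : e = 0.
    have := congr1 (fun z => (1 + q) * z * w) g0.
    by rewrite mulr0 mul0r !mulrA uw mul1r -mulrA uw mulr1.
  move: exq; rewrite e0 !mul0r subr0 => /eqP; rewrite subr_eq0 => /eqP ->.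
  by [].
- by exists (w * (e * (1 - r))); rewrite -mulrA eu !mulrA.
Qed.

Lemma prime_von_neumann_regular (R : pzRingType) (a : R) :
    prime_ring R -> has_PI_terms R -> weakly_nil_clean R ->
  exists r, a = a * r * a.
Proof.
move=> primeR PIR wnc.
pose S (f : R) := is_idempotent f /\ exists r, f = r * a.
have S0 : S 0.
  by split; [rewrite /is_idempotent mulr0 | exists 0; rewrite mul0r].
have [f [[ff [r fE]] maxf]] :=
  exists_maximal_idempotent primeR PIR S0 (fun _ => @proj1 _ _).
rewrite /is_idempotent in ff.
suff /eqP : a * (1 - f) = 0.
  by rewrite mulrBr mulr1 subr_eq0 fE mulrA => /eqP aE; exists r.
apply: nil_left_ideal_eq0 => // s; apply: contrapT.
case/(weakly_nil_clean_idempotent wnc) => g [gg /negP g0 [t gE]]; apply: g0.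
rewrite /is_idempotent in gg.
have gf : g * f = 0 by rewrite gE -!mulrA mulrBl mul1r ff subrr !mulr0.
(* As [g f = 0], [j] is an idempotent orthogonal to [f], so [f + j] is an idempotent above [f].
   Maximality forces [j = 0], that is [g = f g], whence [g = g g = g f g = 0]. *)
pose j := (1 - f) * g.
have fj : f * j = 0 by rewrite /j mulrA mulrBr mulr1 ff subrr mul0r.
have jf : j * f = 0 by rewrite /j -mulrA gf mulr0.
have jj : j * j = j.
  rewrite {2 3}/j mulrBl mul1r mulrBr mulrA jf mul0r subr0.
  by rewrite /j -mulrA gg mulrBl mul1r.
have : f + j = f.
  apply: maxf; last by rewrite mulrDl ff jf addr0.
  - split.
      by rewrite /is_idempotent mulrDl !mulrDr ff fj jf jj addr0 add0r.
    (* Since [f = r a], one has [a (1 - f) = (1 - a r) a], which puts [j] in [R a]. *)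
    exists (r + (1 - f) * t * s * (1 - a * r)).
    rewrite mulrDl -fE /j gE fE; congr (_ + _).
    by rewrite -!mulrA !(mulrBr, mulrBl) !mulr1 !mul1r !mulrA.
  - by rewrite mulrDr ff fj addr0.
rewrite -[RHS]addr0 => /addrI; rewrite /j mulrBl mul1r => /eqP.
by rewrite subr_eq0 => /eqP gfg; rewrite -gg {2}gfg mulrA gf mul0r.
Qed.

(** Complements turn a descending chain into an ascending one: [S] holds the [e] for which the
    idempotent [1 - e] generates some [a^(n+1) R]. *)
Lemma prime_strongly_pi_regular (R : pzRingType) :
    prime_ring R -> has_PI_terms R -> weakly_nil_clean R ->
  strongly_pi_regular R.
Proof.
move=> primeR PIR wnc a.
pose S (e : R) := is_idempotent e /\
  exists n r, 1 - e = a ^+ n.+1 * r /\ (1 - e) * a ^+ n.+1 = a ^+ n.+1.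
have idN (h : R) : h * h = h -> is_idempotent (1 - h).
  by move=> hh; rewrite /is_idempotent mulrBl mul1r mulrBr mulr1 hh subrr subr0.
have [r aE] := prime_von_neumann_regular a primeR PIR wnc.
have Sar : S (1 - a * r).
  split; first by apply: idN; rewrite mulrA -aE.
  by exists 0, r; rewrite subKr expr1 -aE.
have [e [[ee [n [s [hE ha]]]] maxe]] :=
  exists_maximal_idempotent primeR PIR Sar (fun _ => @proj1 _ _).
have [t bE] := prime_von_neumann_regular (a ^+ n.+2) primeR PIR wnc.
move: (1 - e) (subKr 1 e) (idN e ee) hE ha => h eE hh hE ha.
rewrite /is_idempotent in hh; pose g := a ^+ n.+2 * t.
have hb : h * a ^+ n.+2 = a ^+ n.+2 by rewrite exprSr mulrA ha.
have hg : h * g = g by rewrite /g mulrA hb.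
have gb : g * a ^+ n.+2 = a ^+ n.+2 by rewrite -bE.
have gg : g * g = g by rewrite {2}/g mulrA gb.
have ghh : g * h * h = g * h by rewrite -mulrA hh.
have hgh : h * (g * h) = g * h by rewrite mulrA hg.
(* Like [g], the idempotent [g h] generates [a^(n+2) R], but it also satisfies [(g h) h = g h], so
   that [1 - g h] lies above [e]. Maximality then gives [g h = h]. *)
have : 1 - g * h = e.
  apply: maxe; rewrite -?eE.
  - split; first by apply: idN; rewrite mulrA -(mulrA g) hg gg.
    exists n.+1, (t * h); rewrite subKr; split; first by rewrite /g mulrA.
    by rewrite -mulrA hb gb.
  - by rewrite mulrBr mulr1 mulrBl mul1r hgh subrr subr0.
  - by rewrite mulrBl mul1r mulrBr mulr1 ghh subrr subr0.
rewrite -eE => /addrI/oppr_inj ghE.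
exists n.+1; split=> //; exists (t * h * a ^+ n.+1).
by rewrite -{1}ha -{1}ghE /g !mulrA.
Qed.

(** * Quotient by a two-sided ideal *)

Definition two_sided_ideal (R : pzRingType) (P : R -> Prop) : Prop :=
  [/\ P 0, forall x y, P x -> P y -> P (x - y), forall a x, P x -> P (a * x)
    & forall a x, P x -> P (x * a)].

Section IdealQuotient.
Variables (R : pzRingType) (P : R -> Prop).

(** The predicate carries the proof [idP], so that its closure instance can be inferred from the
    predicate alone. *)
Definition ideal_mem (idP : two_sided_ideal P) : {pred R} :=
  fun x : R => `[< P x >].

Variable idP : two_sided_ideal P.

Lemma ideal_mem_zmod_closed : zmod_closed (ideal_mem idP).
Proof.
have [P0 PB _ _] := idP; split=> [|x y /asboolP Px /asboolP Py].
  exact/asboolP.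
by apply/asboolP; apply: PB.
Qed.

HB.instance Definition _ :=
  GRing.isZmodClosed.Build R (ideal_mem idP) ideal_mem_zmod_closed.

Definition quotient_ring : Type := @Quotient.quot R (ideal_mem idP).

HB.instance Definition _ := GRing.Zmodule.on quotient_ring.

Definition quotient_proj (x : R) : quotient_ring :=
  \pi_(@Quotient.quot R (ideal_mem idP))%qT x.

Lemma quotient_proj_eq x y : quotient_proj x = quotient_proj y <-> P (x - y).
Proof.
split=> [/eqP|Pxy].
  by rewrite /quotient_proj -Quotient.idealrBE => /asboolP.
by apply/eqP; rewrite /quotient_proj -Quotient.idealrBE; apply/asboolP.
Qed.

Lemma quotient_proj_zmod_morphism : zmod_morphism quotient_proj.
Proof. by move=> x y; rewrite /quotient_proj raddfB. Qed.

HB.instance Definition _ := GRing.isZmodMorphism.Build R quotient_ring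
  quotient_proj quotient_proj_zmod_morphism.

Definition quotient_repr (x : quotient_ring) : R :=
  repr (x : @Quotient.quot R (ideal_mem idP)).

Lemma quotient_reprK : cancel quotient_repr quotient_proj.
Proof. by move=> x; apply: reprK. Qed.

Definition quotient_mul (x y : quotient_ring) : quotient_ring :=
  quotient_proj (quotient_repr x * quotient_repr y).

Lemma quotient_projM : {morph quotient_proj : x y / x * y >-> quotient_mul x y}.
Proof.
have [_ PB Pl Pr] := idP; move=> x y; apply/quotient_proj_eq.
set x' := quotient_repr _; set y' := quotient_repr _.
have Px : P (x - x') by apply/quotient_proj_eq; rewrite quotient_reprK.
have Py : P (y' - y) by apply/quotient_proj_eq; rewrite quotient_reprK.
have -> : x * y - x' * y' = (x - x') * y - x' * (y' - y).
  by rewrite mulrBl mulrBr opprB addrA subrK.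
by apply: PB; [apply: Pr|apply: Pl].
Qed.

Lemma quotient_mulA : associative quotient_mul.
Proof.
move=> x y z.
rewrite -[x]quotient_reprK -[y]quotient_reprK -[z]quotient_reprK.
by rewrite -!quotient_projM mulrA.
Qed.

Lemma quotient_mul1l : left_id (quotient_proj 1) quotient_mul.
Proof. by move=> x; rewrite -[x]quotient_reprK -quotient_projM mul1r. Qed.

Lemma quotient_mul1r : right_id (quotient_proj 1) quotient_mul.
Proof. by move=> x; rewrite -[x]quotient_reprK -quotient_projM mulr1. Qed.

Lemma quotient_mulDl : left_distributive quotient_mul +%R.
Proof.
move=> x y z.
rewrite -[x]quotient_reprK -[y]quotient_reprK -[z]quotient_reprK.
by rewrite -raddfD -!quotient_projM mulrDl raddfD.
Qed.

Lemma quotient_mulDr : right_distributive quotient_mul +%R.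
Proof.
move=> x y z.
rewrite -[x]quotient_reprK -[y]quotient_reprK -[z]quotient_reprK.
by rewrite -raddfD -!quotient_projM mulrDr raddfD.
Qed.

HB.instance Definition _ := GRing.Zmodule_isPzRing.Build quotient_ring
  quotient_mulA quotient_mul1l quotient_mul1r quotient_mulDl quotient_mulDr.

HB.instance Definition _ := GRing.isMonoidMorphism.Build R quotient_ring
  quotient_proj (conj erefl quotient_projM).

End IdealQuotient.

Lemma ideal_quotient (R : pzRingType) (P : R -> Prop) : two_sided_ideal P ->
  exists (Q : pzRingType) (f : {rmorphism R -> Q}),
    (forall y, exists x, f x = y) /\ forall x, f x = 0 <-> P x.
Proof.
move=> idP; exists (quotient_ring idP), (@quotient_proj R P idP).
split=> [y|x]; first by exists (quotient_repr y); apply: quotient_reprK.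
by rewrite -(rmorph0 (@quotient_proj R P idP)) quotient_proj_eq subr0.
Qed.

(** * Identities as term lists, and transfer to homomorphic images *)

Lemma has_PI_terms_of_PI (R : pzRingType) : PI_ring R -> has_PI_terms R.
Proof.
move=> [f [[m um] f0]].
exists [seq (fmonom_val u, f@_u) | u <- msupp f], (fmonom_val m); split.
  rewrite /terms_coef big_map /= (big_rem m) /=; last first.
    by rewrite -mcoeff_neq0; apply: contraTneq um => ->; rewrite unitr0.
  rewrite eqxx big1_seq ?addr0 // => u /andP[/eqP/val_inj ->].
  by rewrite mem_rem_uniqF // fset_uniq.
by move=> v; rewrite -[RHS](f0 v) /terms_eval big_map.
Qed.

Section Image.
Variables (R S : pzRingType) (f : {rmorphism R -> S}).
Hypothesis surjf : forall y, exists x, f x = y.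

Lemma has_PI_terms_image : has_PI_terms R -> has_PI_terms S.
Proof.
move=> [s [w [uw s0]]]; exists s, w; split=> // v.
have [u uE] := choice (fun i => surjf (v i)).
have := congr1 f (s0 u); rewrite rmorph0 => <-.
rewrite /terms_eval rmorph_sum; apply: eq_bigr => p _.
by rewrite raddfMz /= rmorph_prod; congr (_ *~ _); apply: eq_bigr => i _.
Qed.

Lemma weakly_nil_clean_image : weakly_nil_clean R -> weakly_nil_clean S.
Proof.
move=> wnc y; have [x <-] := surjf y.
have [e [q [ee [n qn] [r exq]]]] := wnc x; exists (f e), (f q); split.
- by rewrite /is_idempotent -rmorphM ee.
- by exists n; rewrite -rmorphXn qn rmorph0.
- by exists (f r); rewrite -!rmorphM -exq !rmorphB.
Qed.

End Image.

(** * Prime ideals from Zorn's lemma *)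

Definition right_regular_mod (R : pzRingType) (a : R) (P : R -> Prop) : Prop :=
  exists n r, P (a ^+ n.+1 - a ^+ n.+2 * r).

Lemma right_regular_mod_iter (R : pzRingType) (a : R) (P : R -> Prop) k :
    two_sided_ideal P -> right_regular_mod a P ->
  exists n r, P (a ^+ n.+1 - a ^+ (n.+1 + k) * r).
Proof.
move=> [P0 PB Pl Pr] [n [r Pn]]; exists n.
elim: k => [|k [s Ps]]; first by exists 1; rewrite addn0 mulr1 subrr.
exists (r * s).
have PN x : P x -> P (- x) by move=> Px; rewrite -sub0r; apply: PB.
have := PN _ (Pr s _ (Pl (a ^+ k) _ Pn)).
rewrite mulrBr mulrBl (mulrA (a ^+ k) (a ^+ n.+2)) -(mulrA _ r s) -!exprD.
rewrite (addnC k n.+1) (_ : k + n.+2 = n.+1 + k.+1)%N => [/(PB _ _ Ps)|].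
  by rewrite opprK subrKA.
by rewrite addnC !addSn addnS.
Qed.

(** Let [I] be the [z] with [z R y] inside [P], and [J] the right annihilator of [I] modulo [P].
    Both contain [P], with [x] in [I] and [y] in [J]; if [x] and [y] avoid [P], then [a] is regular
    modulo [I] and modulo [J]. As [I J] lies in [P], multiplying the two relations gives regularity
    modulo [P]. *)
Lemma maximal_not_regular_prime (R : pzRingType) (a : R) (P : R -> Prop) :
    two_sided_ideal P -> ~ right_regular_mod a P ->
    (forall I, two_sided_ideal I -> ~ right_regular_mod a I ->
      (forall z, P z -> I z) -> forall z, I z -> P z) ->
  forall x y, (forall r, P (x * r * y)) -> P x \/ P y.
Proof.
move=> idP nregP maxP x y Pxy; apply: contrapT => /not_orP[nPx nPy].
have [P0 PB Pl Pr] := idP.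
pose I z := forall r, P (z * r * y).
have idI : two_sided_ideal I.
  split=> [r|u v Iu Iv r|b u Iu r|b u Iu r]; first by rewrite !mul0r.
  - by rewrite !mulrBl; apply: PB.
  - by rewrite -!mulrA; apply: Pl; rewrite mulrA; apply: Iu.
  - by rewrite -(mulrA u); apply: Iu.
pose J z := forall i, I i -> P (i * z).
have idJ : two_sided_ideal J.
  split=> [i _|u v Ju Jv i Ii|b u Ju i Ii|b u Ju i Ii]; first by rewrite mulr0.
  - by rewrite mulrBr; apply: PB; [apply: Ju|apply: Jv].
  - by rewrite mulrA; apply: Ju; have [_ _ _ Ir] := idI; apply: Ir.
  - by rewrite mulrA; apply: Pr; apply: Ju.
have regI : right_regular_mod a I.
  apply: contrapT => nregI; apply: nPx; apply: (maxP I) => // z Pz r.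
  by apply/Pr/Pr.
have regJ : right_regular_mod a J.
  apply: contrapT => nregJ; apply: nPy; apply: (maxP J) => // [z Pz i _|i Ii].
    exact: Pl.
  by rewrite -(mulr1 i); apply: Ii.
have [m [s Js]] := regJ.
(* The gap [m + 2] gives the term in [r * w] the exponent [n + m + 3], matching that of
   [a ^+ n.+1 * a ^+ m.+2 * s]. *)
have [n [r In]] := right_regular_mod_iter m.+2 idI regI.
pose w := a ^+ m.+1 - a ^+ m.+2 * s.
apply: nregP; exists (n + m.+1)%N, (s + r * w).
rewrite mulrDr opprD addrA (mulrA _ r w).
have -> : a ^+ (n + m.+1).+1 - a ^+ (n + m.+1).+2 * s = a ^+ n.+1 * w.
  by rewrite mulrBr (mulrA (a ^+ n.+1)) -!exprD !addSn !addnS.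
rewrite -addnS -addSn -mulrBl; exact: Js.
Qed.

Lemma exists_prime_not_regular (R : pzRingType) (a : R) :
    ~ right_regular_mod a (fun z => z = 0) ->
  exists P : R -> Prop, [/\ two_sided_ideal P, ~ right_regular_mod a P
    & forall x y, (forall r, P (x * r * y)) -> P x \/ P y].
Proof.
move=> nreg0.
(* Membership of 0 is left out so that the union of the empty chain is good; it is recovered from
   maximality. *)
pose good (P : set R) := [/\ forall x y, P x -> P y -> P (x - y),
  forall b x, P x -> P (b * x), forall b x, P x -> P (x * b)
  & ~ right_regular_mod a P].
have [P [[PB Pl Pr nregP] maxP]] : exists P,
    good P /\ forall I, (P `<` I)%classic -> ~ good I.
  apply: Zorn_bigcup => F goodF totF; split.
  - move=> x y [X FX Xx] [Y FY Yy].
    have [XB _ _ _] := goodF _ FX; have [YB _ _ _] := goodF _ FY.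
    have [XY|YX] := totF _ _ FX FY.
      by exists Y => //; apply: YB => //; apply: XY.
    by exists X => //; apply: XB => //; apply: YX.
  - move=> b x [X FX Xx]; exists X => //.
    by have [_ + _ _] := goodF _ FX; apply.
  - move=> b x [X FX Xx]; exists X => //.
    by have [_ _ + _] := goodF _ FX; apply.
  (* Regularity modulo the union is the membership of one element, hence already holds modulo one
     member of the chain. *)
  - move=> [n [r [X FX Xx]]]; have [_ _ _] := goodF _ FX.
    by apply; exists n, r.
(* Without 0, [P] would be empty and the zero ideal a larger good set. *)
have P0 : P 0.
  apply: contrapT => nP0; apply: (maxP [set 0]%classic).
    have noP z : ~ P z by move=> Pz; apply: nP0; rewrite -(subrr z); apply: PB.
    by split=> [z /noP|/(_ 0 erefl)].
  split=> // [x y -> ->|b x ->|b x ->]; first by rewrite /= subr0.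
    by rewrite /= mulr0.
  by rewrite /= mul0r.
exists P; split=> //; apply: (maximal_not_regular_prime (a := a)) => //.
move=> I [_ IB Il Ir] nregI PI z Iz.
apply: contrapT => nPz; apply: (maxP I); first by split=> // /(_ z Iz).
by split.
Qed.

Theorem corollary3p11 (R : pzRingType) :
  weakly_nil_clean R -> PI_ring R -> strongly_pi_regular R.
Proof.
move=> wnc /has_PI_terms_of_PI PIR a; apply: contrapT => nreg.
have [|P [idP nregP primeP]] := exists_prime_not_regular (a := a).
  move=> [n [r /eqP]]; rewrite subr_eq0 => /eqP ar.
  by apply: nreg; exists n.+1; split=> //; exists r.
have [Q [f [surjf ker]]] := ideal_quotient idP.
have primeQ : prime_ring Q.
  move=> x y; have [{}x <-] := surjf x; have [{}y <-] := surjf y => xy0.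
  have [r|/ker|/ker] := primeP x y _; [|by left|by right].
  by apply/ker; rewrite !rmorphM.
have [] := prime_strongly_pi_regular primeQ (has_PI_terms_image surjf PIR)
  (weakly_nil_clean_image surjf wnc) (f a).
move=> [|n] [] // _ [r ar]; have [s sr] := surjf r.
apply: nregP; exists n, s; apply/ker.
by rewrite rmorphB rmorphM !rmorphXn sr -ar subrr.
Qed.
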